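(* Let $j \geq 1$ and let $F_{1}, \dots, F_{j}$ be a separated system. If $s \in \mathbb{N}^{*}$ is a free ultrafilter on $\mathbb{N}$ such that $(F_{1} + \cdots + F_{j}) \cap \mathbb{N} \in s$, then $s \notin \Sigma_{j+1}$.
   Context: $\mathbb{N} = \{1,2,3,\dots\}$ is discrete; $\beta\mathbb{N}$ is the space of ultrafilters on $\mathbb{N}$, with basis of clopen sets $\overline{A} = \{p \in \beta\mathbb{N} : A \in p\}$ for $A \subseteq \mathbb{N}$; each $n\in\mathbb{N}$ is identified with the principal ultrafilter at $n$, and $\mathbb{N}^{*} = \beta\mathbb{N} \setminus \mathbb{N}$ is the set of free (non-principal) ultrafilters. Addition on $\beta\mathbb{N}$ is defined by $A \in p + q \iff \{n \in \mathbb{N} : -n + A \in q\} \in p$, where $-n + A = \{m \in \mathbb{N} : n + m \in A\}$; it is associative, and for each fixed $q$ the map $p \mapsto p+q$ is continuous. The cumulative depth filtration is defined by $\Sigma_{0} = \beta\mathbb{N}$, $\Sigma_{1} = \mathbb{N}^{*}$, and $\Sigma_{k+1} = \overline{\mathbb{N}^{*} + \Sigma_{k}}$ for $k \geq 1$, where $\mathbb{N}^{*} + \Sigma_{k} = \{r + v : r \in \mathbb{N}^{*}, v \in \Sigma_{k}\}$ and the closure is taken in $\beta\mathbb{N}$. Let $e_{n} = 2^{2^{n}}$ for $n \geq 1$. A finite collection $F_{1}, \dots, F_{j}$ of subsets of $\mathbb{Z}$ is a separated system if there are integers $c_{1}, \dots, c_{j} \in \mathbb{Z}$ and pairwise disjoint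 infinite sets $S_{1}, \dots, S_{j} \subseteq \{1, 2, 3, \dots\}$ with $F_{i} = \{ e_{n} + c_{i} : n \in S_{i} \}$ for each $i$. The sum $F_{1} + \cdots + F_{j} = \{x_1 + \cdots + x_j : x_i \in F_i\} \subseteq \mathbb{Z}$ is the sumset. *)

(* Defs.v *)
From HB Require Import structures.
From mathcomp Require Import all_boot all_order all_algebra.
From mathcomp Require Import all_classical topology.

Set Implicit Arguments.
Unset Strict Implicit.
Unset Printing Implicit Defensive.

Import Order.TTheory GRing.Theory Num.Theory.
Local Open Scope classical_set_scope.
Local Open Scope ring_scope.

(* The semigroup N = {1, 2, 3, ...} is the subtype [pnat] of [nat]. *)

Definition pnat := {n : nat | (0 < n)%N}.

Lemma padd_gt0 (m n : pnat) : (0 < val m + val n)%N.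
Proof. by rewrite addn_gt0 (valP m). Qed.

Definition padd (m n : pnat) : pnat := exist _ (val m + val n)%N (padd_gt0 m n).

Record betaN := BetaN {
  betaN_sets :> set pnat -> Prop;
  betaN_ultra : UltraFilter betaN_sets
}.
#[global] Existing Instance betaN_ultra.

HB.instance Definition _ := gen_eqMixin betaN.
HB.instance Definition _ := gen_choiceMixin betaN.

Lemma betaN_ext (p q : betaN) : betaN_sets p = betaN_sets q -> p = q.
Proof.
case: p q => [p pU] [q qU] /= pq; move: pU qU; rewrite pq => pU qU.
by congr BetaN; exact: Prop_irrelevance.
Qed.

Definition basic_clopen (A : set pnat) : set betaN := [set p : betaN | p A].

Lemma basic_clopen_cover : \bigcup_(A in [set: set pnat]) basic_clopen A = setT.
Proof. by rewrite -subTset => p _; exists setT => //; exact: filterT. Qed.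

Lemma basic_clopen_join (A B : set pnat) (p : betaN) :
  [set: set pnat] A -> [set: set pnat] B ->
  basic_clopen A p -> basic_clopen B p ->
  exists C, [/\ [set: set pnat] C, basic_clopen C p &
                basic_clopen C `<=` basic_clopen A `&` basic_clopen B].
Proof.
move=> _ _ pA pB; exists (A `&` B); split => //; first exact: filterI.
by move=> q qAB; split; apply: filterS qAB => n [].
Qed.

HB.instance Definition _ :=
  isBaseTopological.Build betaN basic_clopen_cover basic_clopen_join.

Lemma basic_clopen_open (A : set pnat) : open (basic_clopen A).
Proof. by exists [set A] => //; rewrite bigcup_set1. Qed.

Lemma basic_clopen_basis : basis (range basic_clopen).
Proof.
split=> [_ [A _ <-]|p B]; first exact: basic_clopen_open.
rewrite /= nbhsE => -[U [[D' _ <-] [A D'A pA]] sUB].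
exists (basic_clopen A); first by split => //; exists A.
by move=> q qA; apply: sUB; exists A.
Qed.

Definition principal (n : pnat) : betaN := BetaN (principal_filter_ultra n).

Definition Nstar : set betaN := ~` range principal.

(* [shift n A] is the set -n + A. *)
Definition shift (n : pnat) (A : set pnat) : set pnat :=
  [set m | A (padd n m)].

Definition uadd_sets (p q : set pnat -> Prop) : set_system pnat :=
  [set A | p [set n | q (shift n A)]].

Lemma uadd_ultra (p q : betaN) : UltraFilter (uadd_sets p q).
Proof.
have uE A : uadd_sets p q A = p [set n | q (shift n A)] by [].
have PF : ProperFilter (uadd_sets p q).
  split.
    rewrite uE => p0; apply: (filter_not_empty p).
    by apply: filterS p0 => n /= qn; exact: (filter_not_empty q).
  split=> [|A B|A B AB]; rewrite !uE.
  - by apply: filterS (filterT : p setT) => n _ /=; exact: filterT.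
  - by move=> pA pB; apply: filterS (filterI pA pB) => n /= [qA qB]; exact: filterI.
  - by apply: filterS => n /=; apply: filterS => m; exact: AB.
split=> // G GP sG; rewrite eqEsubset; split=> // A GA; rewrite uE.
have [//|pnA] := in_ultra_setVsetC [set n | q (shift n A)] (betaN_ultra p).
have /sG GnA : uadd_sets p q (~` A).
  rewrite uE; apply: filterS pnA => n /= qnA.
  by have [//|] := in_ultra_setVsetC (shift n A) (betaN_ultra q).
by case: (filter_not_empty G); rewrite -(setICr A); exact: filterI.
Qed.

Definition uadd (p q : betaN) : betaN := BetaN (uadd_ultra p q).

Fixpoint Sigma (k : nat) : set betaN :=
  match k with
  | 0 => setT
  | 1 => Nstar
  | k'.+1 => closure [set uadd r v | r in Nstar & v in Sigma k']
  end%N.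

Definition e (n : pnat) : int := 2 ^+ (2 ^ val n)%N.

Definition separated_system (j : nat) (F : 'I_j -> set int) : Prop :=
  exists (c : 'I_j -> int) (S : 'I_j -> set pnat),
    [/\ trivIset setT S,
        forall i, infinite_set (S i) &
        forall i, F i = [set e n + c i | n in S i]].

Definition sumset (j : nat) (F : 'I_j -> set int) : set int :=
  [set \sum_i x i | x in [set x : 'I_j -> int | forall i, F i (x i)]].

(* [traceN A] is the intersection of A with N, as a subset of N. *)
Definition traceN (A : set int) : set pnat := [set n | A (val n)%:Z].

(* Main.v *)
(** Write [B j c] for the set of naturals of the form [c] plus a sum of [j]
    distinct terms [e n].  By induction on [j], no ultrafilter containing
    [B j c] lies in [Sigma j.+1].  For [j = 0] such an ultrafilter is principal.
    Otherwise [B j c] belongs to some [r + v] with [r] free and [v] in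
    [Sigma j], so [v] contains [(B j c - n) `&` (B j c - m)] for some [n <> m].
    If [x] is in this set, then [x + n] and [x + m] are given by two sums of [j]
    terms whose difference is the fixed nonzero integer [m - n]; by the rapid
    growth of [e], the first sum must involve a term of size at most
    [2 * |m - n|].  So [x] lies in one of finitely many sets [B (j - 1) c'],
    one of which must then belong to [v], contradicting the induction
    hypothesis. *)

From mathcomp Require Import all_boot all_order all_algebra.
From mathcomp Require Import all_classical topology.
From mathcomp Require Import zify.
Require Import Defs.

Set Implicit Arguments.
Unset Strict Implicit.
Unset Printing Implicit Defensive.

Import Order.TTheory GRing.Theory Num.Theory.
Local Open Scope classical_set_scope.
Local Open Scope ring_scope.

Lemma betaN_eq_principal (p : betaN) (n : pnat) : p [set n] -> p = principal n.
Proof.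
move=> pn; apply: betaN_ext; apply/seteqP; split=> A /= pA.
  by have [m [Am mn]] := filter_ex (filterI pA pn);
    apply/principal_filterP; rewrite -mn.
by move/principal_filterP: pA => An; apply: filterS pn => m ->.
Qed.

Lemma Nstar_two_points (p : betaN) (A : set pnat) :
  Nstar p -> p A -> exists m n : pnat, [/\ A m, A n & m <> n].
Proof.
move=> pfree pA; have [m Am] := filter_ex pA.
apply: contrapT => none; apply: pfree; exists m => //.
apply/esym/betaN_eq_principal; apply: filterS pA => n An.
by apply: contrapT => nm; apply: none; exists m, n; split=> // mn; apply: nm.
Qed.

Lemma ultra_bigcup_ord (p : betaN) (K : nat) (A : nat -> set pnat) :
  p [set x | exists2 a, (a < K)%N & A a x] -> exists a, p (A a).
Proof.
elim: K => [|K IH] pA; first by have [x [a]] := filter_ex pA.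
have [pK|pK] := in_ultra_setVsetC (A K) (betaN_ultra p); first by exists K.
apply: IH; apply: filterS (filterI pA pK) => x [[a]].
rewrite ltnS leq_eqVlt => /orP[/eqP->//|aK Aa _]; by exists a.
Qed.

(* [efun k] is [e (k + 1)]; the index is shifted so that [efun_sq] gives
   [3 * efun k <= efun k.+1] for every [k] (note [3 * e 0 > e 1]). *)
Definition efun (k : nat) : int := 2 ^+ (2 ^ k.+1)%N.

Lemma eE (n : pnat) : e n = efun (val n).-1.
Proof. by rewrite /e /efun prednK // (valP n). Qed.

Lemma efun_sq k : efun k.+1 = efun k * efun k.
Proof. by rewrite /efun -exprD [in LHS]expnS mul2n -addnn. Qed.

(** The 4 yields the factor 3 in [efun_step]; the summand [k] later bounds an index by its term. *)
Lemma efun_lower k : 4 + k%:Z <= efun k.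
Proof. elim: k => [//|k IH]; rewrite efun_sq; nia. Qed.

Lemma efun_step k : 3 * efun k <= efun k.+1.
Proof. by have := efun_lower k; rewrite efun_sq; nia. Qed.

Lemma efun_mono m n : (m <= n)%N -> efun m <= efun n.
Proof.
elim: n => [|n IH]; first by case: m.
rewrite leq_eqVlt => /orP[/eqP->//|/IH mn].
by have := efun_step n; have := efun_lower n; lia.
Qed.

(** Index sets as predicates let two sums be compared index by index, from the top down. *)
Definition bsum (p : pred nat) (N : nat) : int := \sum_(i < N | p i) efun i.

Lemma bsumS p N : bsum p N.+1 = bsum p N + (if p N then efun N else 0).
Proof. by rewrite /bsum big_mkcond big_ord_recr [in RHS]big_mkcond. Qed.

Lemma bsum_bounds p N : 0 <= 2 * bsum p N <= efun N.
Proof.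
elim: N => [|N IH]; first by rewrite /bsum big_ord0.
by rewrite bsumS; have := efun_step N; have := efun_lower N; case: (p N); lia.
Qed.

(** If [p] and [q] differ at the top index [N], then by [bsum_bounds] twice the difference is at
    least [efun N], hence at least [efun i]. Otherwise the top terms cancel. *)
Lemma bsum_diff_agree (p q : pred nat) N i :
  (i < N)%N -> 2 * `|bsum q N - bsum p N| < efun i -> p i = q i.
Proof.
elim: N => [//|N IH]; rewrite ltnS => iN.
have := efun_mono iN; rewrite !bsumS.
have := bsum_bounds p N; have := bsum_bounds q N.
case pN: (p N); case qN: (q N) => bq bp mono small; last 1 first.
- move: iN; rewrite leq_eqVlt => /orP[/eqP->|/IH]; first by rewrite pN qN.
  by apply; lia.
- move: iN; rewrite leq_eqVlt => /orP[/eqP->|/IH]; first by rewrite pN qN.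
  by apply; lia.
- by exfalso; lia.
- by exfalso; lia.
Qed.

Lemma seq_sum_bsum (l : seq nat) N :
  uniq l -> (forall i, i \in l -> (i < N)%N) ->
  \sum_(i <- l) efun i = bsum (mem l) N.
Proof.
move=> ul lN; rewrite /bsum -(big_mkord (mem l) efun) -big_filter.
apply: perm_big; apply: uniq_perm => //; first exact/filter_uniq/iota_uniq.
move=> i; rewrite mem_filter mem_index_iota /=.
by case: (boolP (i \in l)) => // /lN ->.
Qed.

(** If all terms of [P] exceeded twice the difference, [bsum_diff_agree] would put [P] inside [Q],
    and equal sizes would make them permutations of each other. *)
Lemma small_term (P Q : seq nat) :
  uniq P -> uniq Q -> size P = size Q ->
  \sum_(i <- P) efun i != \sum_(i <- Q) efun i ->
  exists2 a, a \in P &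
    efun a <= 2 * `|\sum_(i <- Q) efun i - \sum_(i <- P) efun i|.
Proof.
move=> uP uQ sPQ; apply: contra_neqP => none.
have PQ : {subset P <= Q}.
  move=> a aP; have : ~ (efun a <=
      2 * `|\sum_(i <- Q) efun i - \sum_(i <- P) efun i|).
    by move=> ale; apply: none; exists a.
  move/negP; rewrite -ltNge.
  pose N := (\max_(i <- P ++ Q) i).+1.
  have ltN i : i \in P ++ Q -> (i < N)%N.
    by move=> iPQ; rewrite ltnS; exact: leq_bigmax_seq.
  rewrite (@seq_sum_bsum P N) ?(@seq_sum_bsum Q N) //;
    try by move=> i il; apply: ltN; rewrite mem_cat il ?orbT.
  move/bsum_diff_agree => /=; rewrite aP => <- //.
  by apply: ltN; rewrite mem_cat aP.
apply: perm_big; apply: uniq_perm => //.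
by have [|_] := uniq_min_size uP PQ; rewrite ?sPQ.
Qed.

(** The sets [B j c], with the indices in [l] lowered by one as in [efun]. *)
Definition esums (j : nat) (c : int) : set pnat :=
  [set x | exists l : seq nat,
     [/\ uniq l, size l = j & (val x)%:Z = \sum_(i <- l) efun i + c]].

Lemma esums_notin_Sigma (j : nat) (c : int) (s : betaN) :
  s (esums j c) -> ~ Sigma j.+1 s.
Proof.
elim: j c s => [|j IH] c s sB sS.
  have [m [n [[l [_ /size0nil -> em]] [l' [_ /size0nil -> en]] mn]]] :=
    Nstar_two_points sS sB.
  by apply: mn; apply: val_inj; move: em en; rewrite !big_nil; lia.
have /sS [_ [[r rfree [v vS <-]] rvB]] : nbhs s (basic_clopen (esums j.+1 c)).
  exact: open_nbhs_nbhs (conj (basic_clopen_open _) sB).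
have [n [m [vn vm nm]]] := Nstar_two_points rfree rvB.
pose d : int := (val m)%:Z - (val n)%:Z.
pose A a := esums j (c - (val n)%:Z + efun a).
have [a] : exists a, v (A a); last by move=> /IH; apply.
(* The small term satisfies [b < efun b <= 2 * |d|], so finitely many [b] suffice. *)
apply: (@ultra_bigcup_ord v (absz (2 * d)).+1).
apply: filterS (filterI vn vm) => x [[P [uP sP eP]] [Q [uQ sQ eQ]]].
rewrite [LHS]PoszD in eP; rewrite [LHS]PoszD in eQ.
have dE : \sum_(i <- Q) efun i - \sum_(i <- P) efun i = d by rewrite /d; lia.
have neq : \sum_(i <- P) efun i != \sum_(i <- Q) efun i.
  by apply/eqP => PQ; apply: nm; apply: val_inj; move: dE; rewrite PQ /d /=; lia.
have [] := small_term uP uQ _ neq; first by rewrite sP sQ.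
rewrite dE => b bP ble; exists b; first by have := efun_lower b; lia.
exists (rem b P); split; first exact: rem_uniq.
  by rewrite size_rem // sP.
rewrite (perm_big _ (perm_to_rem bP)) big_cons in eP.
move: eP; set t : int := \sum_(i <- rem b P) _ => eP.
by rewrite -/t /= in eP *; lia.
Qed.

Lemma separated_sumset_esums (j : nat) (F : 'I_j -> set int) :
  separated_system F -> exists c, traceN (sumset F) `<=` esums j c.
Proof.
move=> [c [S [disj _ FE]]]; exists (\sum_i c i) => x [y yF yx].
have /choice [n nP] : forall i, exists n, S i n /\ e n + c i = y i.
  by move=> i; have := yF i; rewrite FE => -[n Sn <-]; exists n.
exists [seq (val (n i)).-1 | i <- index_enum 'I_j]; split.
(* Equal indices chosen from [S i] and [S k] force [i = k] by disjointness. *)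
- rewrite map_inj_uniq ?index_enum_uniq // => i k /(congr1 succn).
  rewrite !prednK ?(valP (n _)) // => /val_inj nik.
  apply: disj => //; exists (n i); split; first by case: (nP i).
  by rewrite nik; case: (nP k).
- by rewrite size_map -[RHS]card_ord cardT enumT.
- rewrite big_map -big_split -yx; apply: eq_bigr => i _.
  by rewrite -eE; case: (nP i) => _ <-.
Qed.

Theorem theorem1p3 (j : nat) (F : 'I_j -> set int) (s : betaN) :
  (1 <= j)%N ->
  separated_system F ->
  Nstar s ->
  s (traceN (sumset F)) ->
  ~ Sigma j.+1 s.
Proof.
move=> _ /separated_sumset_esums [c FB] _ sF.
by apply: (@esums_notin_Sigma _ c); apply: filterS sF.
Qed.
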